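(* Let $w_{\mathrm{col}}\ge 1$ and $w_{\mathrm{row}}\ge 2$ be integers, and consider a family (sequence) of binary linear codes, with block length $n\to\infty$, each defined by a $(w_{\mathrm{col}},w_{\mathrm{row}})$-regular parity-check matrix. Suppose the codes are used over a fixed memoryless binary-input output-symmetric channel, the all-zeros codeword is sent, and let $\Gamma$ denote a random variable distributed as the log-likelihood ratio of one channel output, with density $p_\Gamma$. If the probability that the LP decoder decides in favor of the all-zeros codeword tends to $1$ as $n\to\infty$, then $$-\frac{\mathrm{E}[\Gamma\mid \Gamma\ge 0]}{\mathrm{E}[\Gamma\mid\Gamma<0]}\cdot\frac{\Pr(\Gamma\ge 0)}{\Pr(\Gamma<0)}\ \ge\ w_{\mathrm{row}}-1,$$ or, equivalently, $$-\frac{\int_{0^-}^{+\infty}\gamma\,p_\Gamma(\gamma)\,d\gamma}{\int_{-\infty}^{0^-}\gamma\,p_\Gamma(\gamma)\,d\gamma}\ \ge\ w_{\mathrm{row}}-1 .$$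
   Context: A matrix $\mathbf H\in\{0,1\}^{m\times n}$ is $(w_{\mathrm{col}},w_{\mathrm{row}})$-regular if every column contains exactly $w_{\mathrm{col}}$ ones and every row exactly $w_{\mathrm{row}}$ ones. With $\mathbf h_j$ the $j$-th row of $\mathbf H$, let $\mathcal C_j=\{\mathbf x\in\mathbb F_2^n:\mathbf h_j\mathbf x^{\mathsf T}=0 \bmod 2\}$, and let the fundamental polytope be $\mathcal P=\bigcap_{j=1}^m\operatorname{conv}(\mathcal C_j)\subseteq\mathbb R^n$, where $\mathbb F_2=\{0,1\}$ is embedded in $\mathbb R$. For a memoryless channel with law $P_{Y|X}$, input alphabet $\{0,1\}$, and outputs $Y_1,\dots,Y_n$, the log-likelihood ratios are $\Gamma_i=\log\frac{P_{Y|X}(Y_i|0)}{P_{Y|X}(Y_i|1)}$, with realizations $\gamma_i$. The LP decoder outputs $\hat{\boldsymbol\omega}=\arg\min_{\boldsymbol\omega\in\mathcal P}\sum_i\gamma_i\omega_i$; it decides in favor of the all-zeros codeword if $\mathbf 0$ is the unique solution of this linear program. All probabilities are conditioned on the all-zeros codeword being sent; then $\Gamma_1,\dots,\Gamma_n$ are i.i.d. copies of $\Gamma$. The value of $\Gamma$ may be $+\infty$ with positive probability (with the convention $0\cdot\infty=0$). $\mathrm{E}[\Gamma\mid A]\Pr(A)$ means $\mathrm{E}[\Gamma\mathbf 1_A]$, the integrals with density $p_\Gamma$ are to be read as integrals against the distribution of $\Gamma$ (a point mass at $0$ being counted in the first integral), and the ratio is taken to be $+\infty$ if $\Pr(\Gamma<0)=0$.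 *)

(* Defs.v *)
From HB Require Import structures.
From mathcomp Require Import all_boot all_order all_algebra.
From mathcomp Require Import all_classical all_reals all_analysis.
From mathcomp Require Import measurable_realfun.

Set Implicit Arguments.
Unset Strict Implicit.
Unset Printing Implicit Defensive.

Import Order.TTheory GRing.Theory Num.Theory.
Import numFieldNormedType.Exports.

Local Open Scope classical_set_scope.
Local Open Scope ring_scope.

Definition regular_pcm (w_col w_row m n : nat) (H : 'M['F_2]_(m, n)) : Prop :=
  (forall i : 'I_n, #|[set j : 'I_m | H j i == 1]%SET| = w_col) /\
  (forall j : 'I_m, #|[set i : 'I_n | H j i == 1]%SET| = w_row).

Definition check_code (m n : nat) (H : 'M['F_2]_(m, n)) (j : 'I_m) :
    set 'rV['F_2]_n :=
  [set x | row j H *m x^T = 0].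

Definition embed_word (R : realType) (n : nat) (x : 'rV['F_2]_n) : 'rV[R]_n :=
  \row_i (x 0 i : nat)%:R.

Definition conv_hull (R : realType) (V : lmodType R) (A : set V) : set V :=
  [set x | exists (p : nat) (a : 'I_p -> R) (v : 'I_p -> V),
     [/\ forall i, 0 <= a i, \sum_i a i = 1, forall i, A (v i) &
         x = \sum_i a i *: v i]].

Definition fundamental_polytope (R : realType) (m n : nat)
    (H : 'M['F_2]_(m, n)) : set 'rV[R]_n :=
  \bigcap_(j in [set: 'I_m]) conv_hull (@embed_word R n @` check_code H j).

(* Log-likelihood ratios may be infinite; the product of extended reals
   satisfies 0 * +oo = 0. *)
Definition lp_cost (R : realType) (n : nat) (gamma : 'I_n -> \bar R)
    (omega : 'rV[R]_n) : \bar R :=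
  (\sum_(i < n) gamma i * (omega ord0 i)%:E)%E.

Definition lp_solutions (R : realType) (m n : nat) (H : 'M['F_2]_(m, n))
    (gamma : 'I_n -> \bar R) : set 'rV[R]_n :=
  [set omega | fundamental_polytope H omega /\
     forall omega', fundamental_polytope H omega' ->
       (lp_cost gamma omega <= lp_cost gamma omega')%E].

Definition lp_decides_zero (R : realType) (m n : nat) (H : 'M['F_2]_(m, n))
    (gamma : 'I_n -> \bar R) : Prop :=
  lp_solutions H gamma = [set 0].

(* A binary-input channel with an arbitrary measurable output alphabet Y:
   [ch_dens x y] is P_{Y|X}(y|x), a density (or mass function) with respect to a
   common reference measure, e.g. Lebesgue or counting measure. *)
Record bi_channel (R : realType) (d : measure_display) (Y : measurableType d) :=
  BiChannel {
    ch_law : 'F_2 -> probability Y R ;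
    ch_ref : {sigma_finite_measure set Y -> \bar R} ;
    ch_dens : 'F_2 -> Y -> R ;
    ch_dens_ge0 : forall x y, 0 <= ch_dens x y ;
    ch_dens_meas : forall x, measurable_fun [set: Y] (ch_dens x) ;
    ch_lawE : forall x (A : set Y), measurable A ->
      ch_law x A = (\int[ch_ref]_(y in A) (ch_dens x y)%:E)%E
  }.

(* Flipping the input bit amounts to applying an involution of the output
   alphabet, as y |-> -y in the case of a real-valued output. *)
Definition output_symmetric (R : realType) (d : measure_display)
    (Y : measurableType d) (W : bi_channel R Y) : Prop :=
  exists s : Y -> Y,
    [/\ measurable_fun [set: Y] s, involutive s &
        forall (x : 'F_2) (A : set Y), measurable A ->
          ch_law W (x + 1) A = ch_law W x (s @^-1` A)].

(* Equal to +oo where P(y|0) > 0 = P(y|1), and to -oo where P(y|0) = 0; the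
   latter set, which includes the undefined case 0/0, is null when 0 is sent. *)
Definition llr (R : realType) (d : measure_display) (Y : measurableType d)
    (W : bi_channel R Y) (y : Y) : \bar R :=
  lne ((ch_dens W 0 y)%:E / (ch_dens W 1 y)%:E)%E.

(* Yout is the output of n memoryless uses of W when the word x is sent: its
   joint law is the product of the laws W(.|x_i).  In particular the Yout i are
   mutually independent (take A i = setT for the unused indices). *)
Definition memoryless_output (R : realType) (d : measure_display)
    (Y : measurableType d) (W : bi_channel R Y) (dO : measure_display)
    (Omega : measurableType dO) (P : probability Omega R) (n : nat)
    (x : 'rV['F_2]_n) (Yout : 'I_n -> {RV P >-> Y}) : Prop :=
  forall A : 'I_n -> set Y, (forall i, measurable (A i)) ->
    P (\bigcap_(i in [set: 'I_n]) (Yout i @^-1` A i)) =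
    (\prod_(i < n) ch_law W (x ord0 i) (A i))%E.

Definition distributed_as_llr (R : realType) (d : measure_display)
    (Y : measurableType d) (W : bi_channel R Y) (dT : measure_display)
    (T : measurableType dT) (Q : probability T R)
    (Gamma : {RV Q >-> \bar R}) : Prop :=
  forall A : set (\bar R), measurable A ->
    distribution Q Gamma A = ch_law W 0 (llr W @^-1` A).

(* E[X 1_A], which is what E[X | A] Pr(A) stands for; it makes sense for
   infinite X and for null A. *)
Definition mean_on (R : realType) (dT : measure_display)
    (T : measurableType dT) (Q : probability T R) (X : T -> \bar R)
    (A : set T) : \bar R :=
  (\int[Q]_t (X t * (\1_A t)%:E))%E.

(* - num / den, with the convention that it is +oo when the event over which the
   denominator is taken has probability p = 0. *)
Definition neg_ratio (R : realType) (num den p : \bar R) : \bar R :=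
  (if p == 0 then +oo else - (num / den))%E.

(* Main.v *)
(* Write g^+ and g^- for the positive and negative parts of the LLRs and w for
   w_row.  For every LLR vector g, the point x with x_i proportional to w - 1
   where g_i < 0 and to 1 elsewhere lies, after scaling, in the fundamental
   polytope: inside one check with w positions it is a nonnegative combination
   of codewords of weight two.  If 0 is the unique LP solution, then x has
   positive cost, i.e. (w - 1) sum_i g_i^- < sum_i g_i^+.  If the claim failed,
   (w - 1) E[Gamma^-] > E[Gamma^+], and by the weak law of large numbers this
   event would have probability bounded away from 1.

   Besides, E[Gamma^-] is finite since P(Gamma <= -k) <= exp(-k), and the event
   that 0 is the unique solution must be shown measurable, because a measure
   takes arbitrary values on nonmeasurable sets.  It is a countable combination
   of events q_i < Gamma_i with q rational: by compactness, a cost vector that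
   is positive on a compact part of the polytope dominates strictly a rational
   one with the same property. *)

Require Import Defs.
From HB Require Import structures.
From mathcomp Require Import all_boot all_order all_algebra.
From mathcomp Require Import all_classical all_reals all_analysis.
From mathcomp Require Import measurable_realfun.
From mathcomp Require Import ring lra.

Set Implicit Arguments.
Unset Strict Implicit.
Unset Printing Implicit Defensive.

Import Order.TTheory GRing.Theory Num.Theory.
Import numFieldNormedType.Exports.

Local Open Scope classical_set_scope.
Local Open Scope ring_scope.

(** * The fundamental polytope *)

Require Import Defs.
From HB Require Import structures.
From mathcomp Require Import all_boot all_order all_algebra.
From mathcomp Require Import all_classical all_reals all_analysis.
From mathcomp Require Import measurable_realfun.
From mathcomp Require Import ring lra.

Set Implicit Arguments.
Unset Strict Implicit.
Unset Printing Implicit Defensive.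

Import Order.TTheory GRing.Theory Num.Theory.
Import numFieldNormedType.Exports.

Local Open Scope classical_set_scope.
Local Open Scope ring_scope.

(** Merging the points that share a label in the finite type [C] bounds the length of a combination,
    so the hull is parametrised by weights in a fixed finite dimension. *)
Lemma conv_hull_image (R : realType) (V : lmodType R) (C : finType)
    (f : C -> V) (A : set C) (x : V) :
  conv_hull (f @` A) x <-> exists a : C -> R,
    [/\ forall c, 0 <= a c, forall c, ~ A c -> a c = 0,
        \sum_c a c = 1 & x = \sum_c a c *: f c].
Proof.
split=> [[p [a [v [a0 a1 Av ->]]]]|[a [a0 aA a1 ->]]].
  have /choice[g gP] : forall i, exists c, A c /\ f c = v i.
    by move=> i; have [c Ac cv] := Av i; exists c.
  exists (fun c => \sum_(i < p | g i == c) a i); split.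
  - by move=> c; apply: sumr_ge0.
  - move=> c Ac; apply: big1 => i /eqP gi; case: Ac; rewrite -gi.
    by have [] := gP i.
  - by rewrite -a1 (partition_big g predT).
  - rewrite (partition_big g predT)//=; apply: eq_bigr => c _.
    rewrite scaler_suml; apply: eq_bigr => i /eqP gi.
    by have [_ <-] := gP i; rewrite gi.
have [c0 Ac0] : exists c, A c.
  apply: contrapT => /forallNP noA; have := oner_neq0 R.
  by rewrite -a1 big1 ?eqxx// => c _; exact: aA.
(* [conv_hull] asks for membership in [A] even at weight zero, so labels outside [A] are redirected
   to [c0]. *)
exists #|C|, (fun i => a (enum_val i)),
  (fun i => f (if `[< A (enum_val i) >] then enum_val i else c0)); split.
- by [].
- by rewrite -a1 -big_enum_val.
- move=> i /=; case: asboolP => [Ai|_]; first by exists (enum_val i).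
  by exists c0.
- rewrite -(big_enum_val (fun c => a c *: f (if `[< A c >] then c else c0)))/=.
  apply: eq_bigr => c _.
  by case: asboolP => // /aA ->; rewrite !scale0r.
Qed.

Lemma sum_continuous (R : numFieldType) (T : topologicalType)
    (V : normedModType R) (I : Type) (r : seq I) (f : I -> T -> V) :
  (forall i, continuous (f i)) -> continuous (fun x => \sum_(i <- r) f i x).
Proof.
move=> cf; elim: r => [|i r IH].
  by under eq_fun do rewrite big_nil; exact: cst_continuous.
under eq_fun do rewrite big_cons.
by move=> x; apply: continuousD; [exact: cf|exact: IH].
Qed.

(** The weights supported on [A] and summing to 1 form a closed subset of a cube, and the hull is
    its image under a continuous map. *)
Lemma compact_conv_hull_image (R : realType) (n : nat) (C : finType)
    (f : C -> 'rV[R]_n) (A : set C) : compact (conv_hull (f @` A)).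
Proof.
pose S := [set v : 'rV[R]_#|C| | (forall i, `[0, 1]%classic (v ord0 i)) /\
  ((forall c, ~ A c -> v ord0 (enum_rank c) = 0) /\
   \sum_i v ord0 i = 1)].
have cS : compact S.
  apply: (@subclosed_compact _ _
    [set v : 'rV[R]_#|C| | forall i, `[0, 1]%classic (v ord0 i)]).
  - have -> : S = (\bigcap_(i in [set: 'I_#|C|])
         ((fun v : 'rV[R]_#|C| => v ord0 i) @^-1` `[0, 1]%classic)) `&`
      ((\bigcap_(c in ~` A)
         ((fun v : 'rV[R]_#|C| => v ord0 (enum_rank c)) @^-1` [set 0])) `&`
       ((fun v : 'rV[R]_#|C| => \sum_i v ord0 i) @^-1` [set 1])).
      apply/seteqP; split => v.
        by move=> [v0 [v1 v2]]; split; [move=> i _; exact: v0|split].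
      by move=> [v0 [v1 v2]]; split; [move=> i; exact: v0|split].
    apply: closedI; [|apply: closedI].
    + apply: closed_bigI => i _; apply: preimage_closed.
        by move=> v _; exact: coord_continuous.
      exact: itv_closed.
    + apply: closed_bigI => c _; apply: preimage_closed.
        by move=> v _; exact: coord_continuous.
      exact: closed_eq.
    + apply: preimage_closed; last exact: closed_eq.
      move=> v _; apply: sum_continuous => i; exact: coord_continuous.
  - apply: (@rV_compact R^o _ (fun=> `[(0 : R), 1]%classic)) => _.
    exact: segment_compact.
  - by move=> v [].
have -> : conv_hull (f @` A) =
    (fun v : 'rV[R]_#|C| => \sum_c v ord0 (enum_rank c) *: f c) @` S.
  apply/seteqP; split=> x.
    move=> /conv_hull_image[a [a0 aA a1 ->]].
    exists (\row_i a (enum_val i)); last first.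
      by apply: eq_bigr => c _; rewrite mxE enum_rankK.
    split=> [i|]; [|split=> [c Ac|]].
    - rewrite mxE /= in_itv/= a0/= -a1.
      by rewrite (bigD1 (enum_val i))//= lerDl sumr_ge0.
    - by rewrite mxE enum_rankK aA.
    - by under eq_bigr do rewrite mxE; rewrite -big_enum_val.
  move=> [v [v01 [vA v1]] <-]; apply/conv_hull_image.
  exists (fun c => v ord0 (enum_rank c)); split => //.
  - by move=> c; have /= := v01 (enum_rank c); rewrite in_itv/= => /andP[].
  - rewrite -v1 [RHS](reindex (@enum_rank C))//=.
    by exists enum_val => i _; rewrite ?enum_rankK ?enum_valK.
apply: continuous_compact cS; apply: continuous_subspaceT.
apply: sum_continuous => c v; apply: continuousZr_tmp; exact: coord_continuous.
Qed.

Lemma sub_conv_hull (R : realType) (V : lmodType R) (A B : set V) :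
  A `<=` B -> conv_hull A `<=` conv_hull B.
Proof. by move=> AB x [p [a [v [? ? Av ?]]]]; exists p, a, v; split=> // i; apply/AB. Qed.

(** A single check already confines the polytope to a compact hull; without any check the
    intersection would be the whole space. *)
Lemma compact_fundamental_polytope (R : realType) (m n : nat)
    (H : 'M['F_2]_(m, n)) : (0 < m)%N ->
  compact (@fundamental_polytope R m n H).
Proof.
move=> m0; apply: (@subclosed_compact _ _
    (conv_hull (@embed_word R n @` check_code H (Ordinal m0)))).
- apply: closed_bigI => j _; apply: compact_closed; first exact: norm_hausdorff.
  exact: compact_conv_hull_image.
- exact: compact_conv_hull_image.
- by move=> x; exact.
Qed.

Lemma fundamental_polytope_ge0 (R : realType) (m n : nat)
    (H : 'M['F_2]_(m, n)) (x : 'rV[R]_n) i : (0 < m)%N ->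
  fundamental_polytope H x -> 0 <= x ord0 i.
Proof.
move=> m0 /(_ (Ordinal m0) I) /conv_hull_image[a [a0 _ _ ->]].
rewrite summxE; apply: sumr_ge0 => c _; rewrite !mxE.
by apply: mulr_ge0 => //; exact: ler0n.
Qed.

Lemma fundamental_polytope0 (R : realType) (m n : nat)
    (H : 'M['F_2]_(m, n)) : @fundamental_polytope R m n H 0.
Proof.
move=> j _; exists 1%N, (fun=> 1), (fun=> 0); split=> //.
- by rewrite big_ord1.
- move=> _; exists 0; first by rewrite /check_code/= trmx0 mulmx0.
  by apply/rowP => i; rewrite !mxE.
- by rewrite big_ord1 scaler0.
Qed.

(** For [i = i'] this word has weight one and satisfies the check exactly when [i] lies outside it;
    such words serve the positions that the check does not involve. *)
Definition pair_word (n : nat) (i i' : 'I_n) : 'rV['F_2]_n :=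
  \row_k ((k == i) || (k == i'))%:R.

Lemma embed_pair_word (R : realType) (n : nat) (i i' k : 'I_n) :
  embed_word R (pair_word i i') ord0 k = ((k == i) || (k == i'))%:R.
Proof. by rewrite !mxE; case: (_ || _). Qed.

Lemma pair_word_check (m n : nat) (H : 'M['F_2]_(m, n)) (j : 'I_m) (i i' : 'I_n) :
  (if i == i' then H j i != 1 else (H j i == 1) && (H j i' == 1)) ->
  check_code H j (pair_word i i').
Proof.
move=> hii'; rewrite /check_code/=; apply/matrixP => r s; rewrite !ord1 !mxE.
under eq_bigr do rewrite !mxE.
rewrite (bigD1 i)//= eqxx mulr1.
have [ii'|ii'] := eqVneq i i'.
  move: hii'; rewrite ii' eqxx => hi; rewrite big1 ?addr0; last first.
    by move=> k /negbTE kneq; rewrite kneq mulr0.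
  by move: hi; case: (H j i') => -[|[|]]//= p _; apply/val_inj.
move: hii'; rewrite (negbTE ii') => /andP[/eqP -> /eqP Hi'].
rewrite (bigD1 i') 1?eq_sym//= eqxx orbT Hi' big1 ?addr0 ?mulr1.
  by apply/val_inj.
by move=> k /andP[/negbTE -> /negbTE ->]; rewrite mulr0.
Qed.

(** The label [None] stands for the zero codeword, which absorbs the mass missing from 1; hence an
    upper bound on the total mass suffices. *)
Lemma conv_hull_pair_words (R : realType) (m n : nat) (H : 'M['F_2]_(m, n))
    (j : 'I_m) (c : 'I_n -> 'I_n -> R) :
  (forall i i', 0 <= c i i') ->
  (forall i i', ~~ (if i == i' then H j i != 1
                    else (H j i == 1) && (H j i' == 1)) -> c i i' = 0) ->
  \sum_i \sum_i' c i i' <= 1 ->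
  conv_hull (@embed_word R n @` check_code H j)
    (\row_k \sum_i \sum_i' c i i' * ((k == i) || (k == i'))%:R).
Proof.
move=> c0 cN c1.
pose f (o : option ('I_n * 'I_n)) : 'rV[R]_n :=
  if o is Some p then embed_word R (pair_word p.1 p.2) else 0.
pose A : set (option ('I_n * 'I_n)) := [set o | if o is Some p then
  if p.1 == p.2 then H j p.1 != 1 else (H j p.1 == 1) && (H j p.2 == 1)
  else true].
have fA : f @` A `<=` @embed_word R n @` check_code H j.
  move=> _ [[[i i']|] /= Ao <-].
    by exists (pair_word i i') => //; exact: pair_word_check.
  exists 0; first by rewrite /check_code/= trmx0 mulmx0.
  by apply/rowP => i; rewrite !mxE.
apply: (sub_conv_hull fA); apply/conv_hull_image.
exists (fun o => if o is Some p then c p.1 p.2 else 1 - \sum_i \sum_i' c i i').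
have sumo (V : nmodType) (F : option ('I_n * 'I_n) -> V) :
    \sum_o F o = F None + \sum_i \sum_i' F (Some (i, i')).
  rewrite (bigD1 None)//= pair_big/=; congr (_ + _).
  rewrite (reindex_omap Some id)/=; last by case.
  by apply: eq_big => -[i i'] //=; rewrite eqxx.
split.
- by case=> [[i i']|]/=; rewrite ?subr_ge0.
- by case=> [[i i']|]//= /negP; exact: cN.
- by rewrite sumo/= subrK.
- rewrite sumo/= scaler0 add0r; apply/rowP => k; rewrite mxE summxE.
  apply: eq_bigr => i _; rewrite summxE; apply: eq_bigr => i' _.
  by rewrite [RHS]mxE embed_pair_word.
Qed.

Lemma sum_pair_incident (R : pzRingType) (I : finType) (F : I -> I -> R)
    (k : I) :
  \sum_i \sum_i' F i i' * ((k == i) || (k == i'))%:R =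
  F k k + \sum_(i | i != k) (F k i + F i k).
Proof.
rewrite (bigD1 k)//= eqxx/= (bigD1 k)//= mulr1 -addrA; congr (_ + _).
rewrite big_split/=; congr (_ + _); first by apply: eq_bigr => i _; rewrite mulr1.
apply: eq_bigr => i ik; rewrite (bigD1 k)//= eqxx orbT mulr1 big1 ?addr0//.
by move=> i' i'k; rewrite eq_sym (negbTE ik) eq_sym (negbTE i'k) mulr0.
Qed.

(** * The sign point as a combination of words of weight at most two *)

Section sign_point.
Variables (R : realType) (m n w : nat) (H : 'M['F_2]_(m, n)) (j : 'I_m).
Hypotheses (w2 : (2 <= w)%N) (Hw : #|[set i : 'I_n | H j i == 1]%SET| = w).
Variables (neg : pred 'I_n) (e : R).
Hypotheses (e0 : 0 <= e) (ew : e * (n * w)%:R <= 1).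

Let x k : R := e * (if neg k then w%:R - 1 else 1).
Let a : R := (#|[set i : 'I_n | (H j i == 1) && neg i]%SET|)%:R.
Let b : R := (#|[set i : 'I_n | (H j i == 1) && ~~ neg i]%SET|)%:R.

(* Mass put on the pair {i, i'} inside the check, by the signs of i and i':
   these weights solve the degree equations
   a * q s true + b * q s false - q s s = if s then w - 1 else 1. *)
Let q (s s' : bool) : R :=
  if s && s' then w%:R / a
  else if s || s' then a^-1 else if a == 0 then (w%:R - 1)^-1 else 0.

Let ab : a + b = w%:R.
Proof.
rewrite -natrD -[in RHS]Hw; congr (_%:R).
rewrite -(cardsID [set i | neg i]%SET [set i | H j i == 1]%SET); congr addn.
  by apply: eq_card => i; rewrite !inE.
by apply: eq_card => i; rewrite !inE andbC.
Qed.

Let w1 : 1 <= w%:R - 1 :> R.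
Proof. by rewrite lerBrDl -(natrD _ 1 1) ler_nat. Qed.

Let q_ge0 s s' : 0 <= q s s'.
Proof.
rewrite /q; case: ifPn => _; first by rewrite divr_ge0// ler0n.
case: ifPn => _; first by rewrite invr_ge0 ler0n.
by case: ifPn => // _; rewrite invr_ge0 (le_trans ler01).
Qed.

(** Subtracting [q s s] accounts for a position not being paired with itself. If the check has
    negative positions, each other position spreads its unit over them, and they supply the rest of
    [w - 1] to one another. If it has none, the [w] positions share evenly, each with [w - 1]
    partners. *)
Let q_deg (s : bool) : (s -> a != 0) ->
  a * q s true + b * q s false - q s s = if s then w%:R - 1 else 1.
Proof.
rewrite /q; case: s => /= [/(_ isT) a0|_].
  by rewrite -ab; field.
have [a0|a0] := eqVneq a 0; last by rewrite mulfV// mulr0 subr0 addr0.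
have -> : b = w%:R by rewrite -ab a0 add0r.
rewrite a0 mul0r add0r -[X in _ - X]mul1r -mulrBl mulfV//.
by rewrite gt_eqF// (lt_le_trans ltr01).
Qed.

(** A pair inside the check occurs in both orders, hence [e / 2]. The diagonal vanishes there, a
    word of weight one violating the check, and carries all of [x i] outside. *)
Let c (i i' : 'I_n) : R :=
  if i == i' then (if H j i == 1 then 0 else x i)
  else if (H j i == 1) && (H j i' == 1) then e / 2 * q (neg i) (neg i') else 0.

Let x_ge0 k : 0 <= x k.
Proof. by apply: mulr_ge0 => //; case: ifP => // _; exact: le_trans w1. Qed.

Let c_ge0 i i' : 0 <= c i i'.
Proof.
rewrite /c; case: ifP => _; first by case: ifP.
by case: ifP => // _; rewrite mulr_ge0// divr_ge0.
Qed.

Let sum_check (G : bool -> R) :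
  \sum_(i | H j i == 1) G (neg i) = a * G true + b * G false.
Proof.
rewrite (bigID neg)/=; congr (_ + _).
  rewrite (eq_bigr (fun=> G true)); last by move=> i /andP[_ ->].
  by rewrite sumr_const /a mulr_natl; congr (_ *+ _); apply: eq_card => i; rewrite !inE.
rewrite (eq_bigr (fun=> G false)); last by move=> i /andP[_ /negbTE ->].
by rewrite sumr_const /b mulr_natl; congr (_ *+ _); apply: eq_card => i; rewrite !inE.
Qed.

Let c_deg k : \sum_i \sum_i' c i i' * ((k == i) || (k == i'))%:R = x k.
Proof.
rewrite sum_pair_incident.
have [Hk|Hk] := boolP (H j k == 1); last first.
  rewrite big1 ?addr0 /c ?eqxx ?(negbTE Hk)//= => i ik.
  by rewrite eq_sym (negbTE ik) andbF addr0.
rewrite /c eqxx Hk add0r.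
transitivity (\sum_(i | (H j i == 1) && (i != k)) e * q (neg k) (neg i)).
  rewrite [LHS](bigID (fun i => H j i == 1))/= [X in _ + X]big1 ?addr0.
    rewrite (eq_bigl (fun i => (H j i == 1) && (i != k))); last first.
      by move=> i; rewrite andbC.
    apply: eq_bigr => i /andP[Hi ik].
    have -> : q (neg i) (neg k) = q (neg k) (neg i).
      by rewrite /q andbC orbC.
    by rewrite eq_sym (negbTE ik) Hi/= -mulrDl -splitr.
  move=> i /andP[ik /negbTE Hi].
  by rewrite eq_sym (negbTE ik) Hi/= addr0.
rewrite -mulr_sumr /x; congr (_ * _); rewrite -q_deg.
  by rewrite -(sum_check (q (neg k))) [in RHS](bigD1 k)//= addrC addrK.
move=> nk; rewrite pnatr_eq0 cards_eq0; apply/set0Pn; exists k.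
by rewrite inE Hk.
Qed.

Lemma sign_point_check : conv_hull (@embed_word R n @` check_code H j) (\row_k x k).
Proof.
have -> : \row_k x k = \row_k \sum_i \sum_i' c i i' * ((k == i) || (k == i'))%:R.
  by apply/rowP => k; rewrite !mxE c_deg.
apply: conv_hull_pair_words => //.
  move=> i i'; rewrite /c; case: eqVneq => _; first by rewrite negbK => ->.
  by move/negbTE ->.
(* The mass [c i i'] is counted at least once among the degrees, namely at [k = i]. The total is
   thus at most the sum of the [x k], each of which is at most [e * w]. *)
apply: (@le_trans _ _ (\sum_k x k)).
  under [leRHS]eq_bigr do rewrite -c_deg.
  rewrite [leRHS]exchange_big/=; apply: ler_sum => i _.
  rewrite [leRHS]exchange_big/=; apply: ler_sum => i' _.
  rewrite (bigD1 i)//= eqxx/= mulr1 lerDl sumr_ge0// => k _.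
  by rewrite mulr_ge0// ler0n.
apply: le_trans ew; rewrite natrM mulrA [e * _]mulrC -mulrA mulr_natl.
rewrite -[n in _ *+ n]card_ord -sumr_const; apply: ler_sum => k _.
rewrite /x ler_wpM2l//; case: ifP => _; first by rewrite gerBl.
by rewrite ler1n ltnW.
Qed.

End sign_point.

Lemma sign_point_polytope (R : realType) (m n w : nat) (H : 'M['F_2]_(m, n))
    (neg : pred 'I_n) (e : R) : (2 <= w)%N ->
  (forall j : 'I_m, #|[set i : 'I_n | H j i == 1]%SET| = w) ->
  0 <= e -> e * (n * w)%:R <= 1 ->
  fundamental_polytope H (\row_k (e * (if neg k then w%:R - 1 else 1))).
Proof. by move=> w2 Hw e0 ew j _; exact: sign_point_check (Hw j) _ _ e0 ew. Qed.

(** * Measurability of the decoding event *)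

(** Excluding the limit -oo keeps every partial sum of limits away from the undefined sum of +oo and
    -oo. *)
Lemma cvge_sum (R : realFieldType) (I : Type) (r : seq I) (T : Type)
    (F : set_system T) {FF : Filter F} (f : I -> T -> \bar R) (l : I -> \bar R) :
  (forall i, l i != -oo%E) -> (forall i, f i x @[x --> F] --> l i) ->
  (\sum_(i <- r) f i x)%E @[x --> F] --> (\sum_(i <- r) l i)%E.
Proof.
move=> lNy fl; elim: r => [|i r IH].
  by under eq_fun do rewrite big_nil; rewrite big_nil; exact: cvg_cst.
under eq_fun do rewrite big_cons; rewrite big_cons.
apply: cvgeD => //; apply: ltninfty_adde_def; rewrite inE ltNye//.
by elim/big_ind: _ => // x y; rewrite adde_eq_ninfty negb_or => -> ->.
Qed.

(* Reals increasing to x <> -oo from below, strictly so that [near_covering] can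
   later be combined with the density of the rationals. *)
Definition lower_approx (R : realType) (x : \bar R) (N : nat) : R :=
  if x == +oo%E then N%:R else fine x - N.+1%:R^-1.

Lemma lower_approx_lt (R : realType) (x : \bar R) (N : nat) :
  x != -oo%E -> ((lower_approx x N)%:E < x)%E.
Proof.
rewrite /lower_approx; case: x => [x _| _|] //=; last by rewrite ltry.
by rewrite lte_fin ltrBlDr ltrDl invr_gt0.
Qed.

Lemma lower_approx_le (R : realType) (x : \bar R) (N M : nat) :
  (N <= M)%N -> lower_approx x N <= lower_approx x M.
Proof.
move=> NM; rewrite /lower_approx; case: ifPn => _; first by rewrite ler_nat.
by rewrite lerB// lef_pV2 ?posrE ?ltr0n// ler_nat.
Qed.

Lemma cvg_lower_approx (R : realType) (x : \bar R) : x != -oo%E ->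
  (lower_approx x N)%:E @[N --> \oo] --> x.
Proof.
rewrite /lower_approx; case: x => [x _|_|//] /=.
  apply: cvg_EFin; first by near=> N.
  rewrite -[X in _ --> X]subr0; apply: cvgB; first exact: cvg_cst.
  exact: cvg_harmonic.
by apply/cvgeryP; exact: cvgr_idn.
Unshelve. all: by end_near. Qed.

Lemma near_lower_approx (R : realType) (n : nat) (g : 'I_n -> \bar R)
    (x : 'I_n -> R) :
  (forall i, g i != -oo%E) -> (forall i, 0 <= x i) ->
  (0 < \sum_i g i * (x i)%:E)%E ->
  \forall N \near \oo, 0 < \sum_i lower_approx (g i) N * x i.
Proof.
move=> gNy x0 gx.
have gxNy i : (g i * (x i)%:E)%E != -oo%E.
  have := x0 i; rewrite le_eqVlt => /predU1P[<-|xi0]; first by rewrite mule0.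
  by have := gNy i; case: (g i) => [r| |]// _; rewrite gt0_mulye// lte_fin.
have cv : (\sum_i (lower_approx (g i) N)%:E * (x i)%:E)%E @[N --> \oo] -->
    (\sum_i g i * (x i)%:E)%E.
  apply: cvge_sum => // i; apply: cvgeZr => //; exact: cvg_lower_approx.
have := cv _ (open_ereal_gt' gx); rewrite /= => h.
near=> N; rewrite -lte_fin -sumEFin.
by under eq_bigr do rewrite EFinM; near: N; exact: h.
Unshelve. all: by end_near. Qed.

(** At each point of [K] some real level below [g] gives positive cost. This persists nearby by
    continuity and at higher levels by monotonicity, so compactness yields one level for all of
    [K]. *)
Lemma compact_lower_rat (R : realType) (n : nat) (K : set 'rV[R]_n)
    (g : 'I_n -> \bar R) :
  compact K -> (forall x, K x -> forall i, 0 <= x ord0 i) ->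
  (forall i, g i != -oo%E) -> (forall x, K x -> (0 < lp_cost g x)%E) ->
  exists q : {ffun 'I_n -> rat}, (forall i, ((ratr (q i))%:E < g i)%E) /\
    forall x, K x -> 0 < \sum_i ratr (q i) * x ord0 i.
Proof.
move=> cK K0 gNy Kg.
have /compact_near_coveringP/near_covering_withinP := cK.
move=> /(_ nat \oo (fun N x => 0 < \sum_i lower_approx (g i) N * x ord0 i) _).
case=> [x Kx|N _ /(_ N (leqnn N)) KN].
  have /= [N _ /(_ N (leqnn N)) gN] := near_lower_approx gNy (K0 _ Kx) (Kg _ Kx).
  have cN : continuous (fun y : 'rV[R]_n =>
      \sum_i lower_approx (g i) N * y ord0 i).
    apply: sum_continuous => i y.
    exact: (cvgMl_tmp (@coord_continuous R 1 n ord0 i y)).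
  have := cvgr_gt _ (cN x) _ gN => nx.
  near=> y M => Ky.
  apply: (@lt_le_trans _ _ (\sum_i lower_approx (g i) N * y ord0 i)).
    by near: y; exact: nx.
  have NM : (N <= M)%N by near: M; exists N.
  by apply: ler_sum => i _; rewrite ler_wpM2r ?K0// lower_approx_le.
(* A rational fits because [lower_approx] stays strictly below [g i]; raising a coefficient
   preserves positivity on [K], whose points are nonnegative. *)
have q_ex i : exists q : rat, lower_approx (g i) N <= ratr q /\
    ((ratr q)%:E < g i)%E.
  have := lower_approx_lt N (gNy i).
  have := gNy i; case: (g i) => [r _|_ _|//].
    rewrite lte_fin => /rat_in_itvoo[q]; rewrite in_itv/= => /andP[q1 q2].
    by exists q; rewrite (ltW q1) lte_fin.
  have /rat_in_itvoo[q] : lower_approx +oo%E N < (lower_approx (+oo%E : \bar R) N) + 1.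
    by rewrite ltrDl.
  by rewrite in_itv/= => /andP[q1 q2]; exists q; rewrite (ltW q1) ltry.
have [q qP] := choice q_ex.
exists [ffun i => q i]; split=> [i|x Kx]; first by rewrite ffunE; have [] := qP i.
apply: lt_le_trans (KN x Kx) _; apply: ler_sum => i _.
by rewrite ffunE ler_wpM2r ?K0//; have [] := qP i.
Unshelve. all: by end_near. Qed.

Lemma lp_cost0 (R : realType) (n : nat) (g : 'I_n -> \bar R) :
  lp_cost g 0 = 0%E.
Proof. by rewrite /lp_cost big1// => i _; rewrite mxE mule0. Qed.

(** The cost of 0 is 0, so a nonzero feasible point of cost 0 would be a second minimiser. *)
Lemma lp_decides_zeroP (R : realType) (m n : nat) (H : 'M['F_2]_(m, n))
    (g : 'I_n -> \bar R) :
  lp_decides_zero H g <-> forall x : 'rV[R]_n,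
    fundamental_polytope H x -> x != 0 -> (0 < lp_cost g x)%E.
Proof.
have P0 := @fundamental_polytope0 R _ _ H.
split=> [Hg x Px x0|Hg].
  have /= [_ g_ge0] : lp_solutions H g 0 by rewrite Hg.
  have := g_ge0 _ Px; rewrite lp_cost0 le_eqVlt => /predU1P[gx|//].
  suff : lp_solutions H g x by rewrite Hg/= => /eqP; rewrite (negbTE x0).
  split=> // y Py; rewrite -gx; have := g_ge0 _ Py.
  by rewrite lp_cost0.
apply/seteqP; split=> [x [Px /(_ _ P0)]|_ ->].
  rewrite lp_cost0 leNgt => /negP gx; apply/eqP; apply/negP => /negP x0.
  by apply: gx; exact: Hg.
split=> // y Py; have [->//|y0] := eqVneq y 0.
by rewrite lp_cost0 ltW// Hg.
Qed.

(** The successor keeps the scale positive even for [n = 0], while [n * w] times the scale stays at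
    most 1. *)
Definition sign_point (R : realType) (n w : nat) (g : 'I_n -> \bar R) : 'rV[R]_n :=
  \row_k (((n * w).+1%:R)^-1 * (if (g k < 0)%E then w%:R - 1 else 1)).

Section sign_point_cost.
Variables (R : realType) (m n w : nat) (H : 'M['F_2]_(m, n)).
Hypotheses (w2 : (2 <= w)%N)
  (Hw : forall j : 'I_m, #|[set i : 'I_n | H j i == 1]%SET| = w).
Variable g : 'I_n -> \bar R.

Lemma sign_point_in : fundamental_polytope H (sign_point w g).
Proof.
apply: (@sign_point_polytope R _ _ w H (fun k => (g k < 0)%E)) => //.
by rewrite ler_pdivrMl// mulr1 ler_nat.
Qed.

Lemma sign_point_gt0 i : 0 < sign_point w g ord0 i.
Proof.
rewrite mxE mulr_gt0 ?invr_gt0//; case: ifP => // _.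
by rewrite subr_gt0 ltr1n.
Qed.

Lemma lp_decides_zero_sign_point : lp_decides_zero H g -> (0 < n)%N ->
  (0 < lp_cost g (sign_point w g))%E.
Proof.
move=> /lp_decides_zeroP Hg n0; apply: Hg; first exact: sign_point_in.
apply/eqP => /rowP/(_ (Ordinal n0)); apply/eqP.
by rewrite [X in _ != X]mxE gt_eqF// sign_point_gt0.
Qed.

(** All coordinates of the sign point are positive, and -oo wins any sum of extended reals; one
    infinite negative LLR would give that point cost -oo. *)
Lemma lp_decides_zero_gtNy i : lp_decides_zero H g -> g i != -oo%E.
Proof.
move=> /lp_decides_zero_sign_point Hg; apply/eqP => gi.
have /Hg : (0 < n)%N by exact: leq_ltn_trans (ltn_ord i).
suff -> : lp_cost g (sign_point w g) = -oo%E by [].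
apply/eqP; rewrite esum_eqNy; apply/existsP; exists i.
by rewrite gi/= gt0_mulNye// lte_fin; exact: sign_point_gt0.
Qed.

End sign_point_cost.

Lemma measurable_lp_decides_zero (R : realType) (m n w : nat)
    (H : 'M['F_2]_(m, n)) (d : measure_display) (T : measurableType d)
    (g : 'I_n -> T -> \bar R) :
  (2 <= w)%N -> (forall j : 'I_m, #|[set i : 'I_n | H j i == 1]%SET| = w) ->
  (0 < m)%N -> (forall i, measurable_fun [set: T] (g i)) ->
  measurable [set t | lp_decides_zero H (g^~ t)].
Proof.
move=> w2 Hw m0 mg.
(* Positivity fails at 0 itself, so the polytope is exhausted by compact slices away from 0. Each
   nonzero point lies in some slice since its coordinates are nonnegative. *)
pose K (M : nat) : set 'rV[R]_n := fundamental_polytope H `&`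
  [set x | M.+1%:R^-1 <= \sum_i x ord0 i].
have cK M : compact (K M).
  apply: compact_closedI; first exact: compact_fundamental_polytope.
  apply: (@preimage_closed _ _ (fun x : 'rV[R]_n => \sum_i x ord0 i)
    [set y | M.+1%:R^-1 <= y]); last exact: closed_ge.
  by move=> x _; apply: sum_continuous => i; exact: coord_continuous.
have K0 M x : K M x -> forall i, 0 <= x ord0 i.
  by move=> [Px _] i; exact: fundamental_polytope_ge0 Px.
pose good M (q : {ffun 'I_n -> rat}) :=
  forall x, K M x -> 0 < \sum_i ratr (q i) * x ord0 i.
have -> : [set t | lp_decides_zero H (g^~ t)] = \bigcap_M \bigcup_q
    [set t | good M q /\ forall i, ((ratr (q i))%:E < g i t)%E].
  apply/seteqP; split=> t /= Ht.
    move=> M _; have [] := @compact_lower_rat R n (K M) (g^~ t) (cK M) (K0 M).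
    - by move=> i; exact: (@lp_decides_zero_gtNy R m n w H w2 Hw (g^~ t) i Ht).
    - move=> x [Px Mx]; move/lp_decides_zeroP: Ht; apply => //.
      apply: contraTneq Mx => ->; rewrite big1 ?lerNgt -?ltNge ?invr_gt0//.
      by move=> i _; rewrite mxE.
    - by move=> q [qg gq]; exists q.
  apply/lp_decides_zeroP => x Px x0.
  have sx0 : 0 < \sum_i x ord0 i.
    have x_ge0 i : 0 <= x ord0 i by exact: fundamental_polytope_ge0 Px.
    rewrite lt_neqAle sumr_ge0// andbT eq_sym; apply: contra_neq x0 => sx.
    apply/rowP => i; rewrite mxE; apply/eqP.
    have /eqP := sx; rewrite psumr_eq0// => /allP/(_ i).
    by rewrite mem_index_enum => /(_ isT).
  have [M Mx] : exists M : nat, M.+1%:R^-1 <= \sum_i x ord0 i.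
    exists (Num.truncn (\sum_i x ord0 i)^-1).
    rewrite -[leRHS]invrK lef_pV2 ?posrE ?invr_gt0//.
    by apply/ltW; exact: truncnS_gt.
  have [q _ [gq qg]] := Ht M I.
  have : K M x by [].
  move=> /gq; rewrite -lte_fin => /lt_le_trans; apply.
  rewrite -sumEFin; apply: lee_sum => i _; rewrite EFinM.
  by apply: lee_wpmul2r; [rewrite lee_fin (K0 M x)|exact/ltW].
apply: bigcap_measurableType => M _.
apply: countable_bigcupT_measurable => [|q]; first exact: countableP.
(* [good M q] does not depend on [t]: the event is either empty or a finite intersection of events
   [q i < g i t]. *)
have [gq|gq] := pselect (good M q); last first.
  by rewrite (_ : [set _ | _] = set0)//; apply/seteqP; split => t [].
rewrite (_ : [set _ | _] = \bigcap_(i in [set: 'I_n])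
    [set t | ((ratr (q i))%:E < g i t)%E]).
  apply: fin_bigcap_measurable => // i _.
  have := emeasurable_fun_o_infty measurableT (mg i) (ratr (q i))%:E.
  by rewrite setTI.
apply/seteqP; split=> t; first by move=> [_ gt] i _; exact: gt.
by move=> gt; split=> // i; exact: gt.
Qed.

(** * A weak law of large numbers *)

Lemma bounded_integrable (R : realType) (d : measure_display) (T : measurableType d)
    (m : probability T R) (f : T -> R) (B : R) : measurable_fun [set: T] f ->
  (forall x, `|f x| <= B) -> m.-integrable [set: T] (EFin \o f).
Proof.
move=> mf fB; apply: measurable_bounded_integrable => //.
  by apply: (@le_lt_trans _ _ 1%E); [exact: probability_le1|rewrite ltry].
exists B; split; first exact: num_real.
by move=> M BM x _ /=; rewrite (le_trans (fB x))// ltW.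
Qed.

(** * Second moment of a sum of bounded centred i.i.d. variables *)

Section iid_sample.
Context (R : realType) (dY : measure_display) (Y : measurableType dY)
  (mu : probability Y R) (dO : measure_display) (Omega : measurableType dO)
  (P : probability Omega R) (n : nat) (X : 'I_n -> {RV P >-> Y}).
Hypothesis iidX : forall A : 'I_n -> set Y, (forall i, measurable (A i)) ->
  P (\bigcap_(i in [set: 'I_n]) (X i @^-1` A i)) = (\prod_(i < n) mu (A i))%E.

Lemma iid_distribution i A : measurable A -> distribution P (X i) A = mu A.
Proof.
move=> mA; pose B k := if k == i then A else setT.
have mB k : measurable (B k) by rewrite /B; case: ifP.
have -> : mu A = (\prod_k mu (B k))%E.
  rewrite (bigD1 i)//= /B eqxx big1 ?mule1// => k /negbTE ->.
  by rewrite probability_setT.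
rewrite -iidX//; congr (P _); apply/seteqP; split=> w /=.
  by move=> Aw k _; rewrite /B; case: eqP => // ->.
by move=> /(_ i I); rewrite /B eqxx.
Qed.

Lemma iid_pair i j A B : i != j -> measurable A -> measurable B ->
  P ((X i @^-1` A) `&` (X j @^-1` B)) = (mu A * mu B)%E.
Proof.
move=> ij mA mB; pose C k := if k == i then A else if k == j then B else setT.
have mC k : measurable (C k) by rewrite /C; do 2 case: ifP => //.
have -> : (mu A * mu B)%E = (\prod_k mu (C k))%E.
  rewrite (bigD1 i)//= (bigD1 j) 1?eq_sym//= /C eqxx eq_sym (negbTE ij) eqxx.
  by rewrite big1 ?mule1// => k /andP[/negbTE -> /negbTE ->]; rewrite probability_setT.
rewrite -iidX//; congr (P _); apply/seteqP; split=> w /=.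
  by move=> [Aw Bw] k _; rewrite /C; case: eqP => [->//|_]; case: eqP => [->//|_].
move=> Cw; split; first by have := Cw i I; rewrite /C eqxx.
by have := Cw j I; rewrite /C eq_sym (negbTE ij) eqxx.
Qed.

Lemma iid_ge0_integral i (f : Y -> \bar R) : measurable_fun [set: Y] f ->
  (forall y, 0 <= f y)%E -> (\int[P]_w f (X i w) = \int[mu]_y f y)%E.
Proof.
move=> mf f0; rewrite [RHS](eq_measure_integral (distribution P (X i)))/=; last first.
  by move=> A mA _; rewrite iid_distribution.
by rewrite ge0_integral_distribution.
Qed.

Variables (u : Y -> R) (C : R).
Hypotheses (mu_ : measurable_fun [set: Y] u) (uC : forall y, `|u y| <= C).

Hypothesis u0 : (\int[mu]_y (u y)%:E = 0)%E.

Let uu_bound y y' : `|u y * u y'| <= C * C.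
Proof. by rewrite normrM ler_pM. Qed.

(** The joint law of two samples agrees with the product measure on rectangles, hence everywhere,
    and Fubini reduces the integral to the vanishing mean of [u]. *)
Lemma iid_uncorrelated i j : i != j ->
  (\int[P]_w (u (X i w) * u (X j w))%:E = 0)%E.
Proof.
move=> ij.
have mphi : measurable_fun [set: Omega] (fun w => (X i w, X j w)).
  by apply/measurable_fun_pair; exact: measurable_funPT.
pose Z : {mfun Omega >-> (Y * Y)%type} :=
  HB.pack (fun w => (X i w, X j w)) (isMeasurableFun.Build _ _ _ _ _ mphi).
pose f (y : Y * Y) : R := u y.1 * u y.2.
have mf : measurable_fun [set: Y * Y] f.
  by apply: measurable_funM; apply: measurableT_comp.
have intf (m : probability (Y * Y)%type R) : m.-integrable [set: Y * Y] (EFin \o f).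
  by apply: (bounded_integrable _ mf (B := C * C)) => y; exact: uu_bound.
transitivity (\int[distribution P Z]_y (f y)%:E)%E.
  rewrite integral_distribution//; first exact/measurable_EFinP.
  apply: (@bounded_integrable _ _ _ _ _ (C * C)) => [|w]; last exact: uu_bound.
  exact: measurableT_comp.
rewrite (eq_measure_integral (mu \x mu)%E)/=; last first.
  move=> A mA _; apply/esym; apply: product_measure_unique => // B D mB mD.
  rewrite -(iid_pair ij)//.
rewrite -integral12_prod_meas1/fubini_F/=; last exact: intf.
under eq_integral do under eq_integral do rewrite EFinM.
rewrite integral0_eq// => y _.
have -> := integralZl measurableT (bounded_integrable mu mu_ uC) (u y).
by rewrite u0 mule0.
Qed.

(** Cross terms vanish; the [n] diagonal terms are each at most [C * C]. *)
Lemma iid_second_moment :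
  (\int[P]_w ((\sum_i u (X i w)) ^+ 2)%:E <= (n%:R * (C * C))%:E)%E.
Proof.
have muX i : measurable_fun [set: Omega] (fun w => u (X i w)).
  exact: measurableT_comp.
have -> : (\int[P]_w ((\sum_i u (X i w)) ^+ 2)%:E =
    \sum_i \sum_j \int[P]_w (u (X i w) * u (X j w))%:E)%E.
  under eq_integral => w _.
    rewrite expr2 mulr_suml.
    under eq_bigr do rewrite mulr_sumr.
    rewrite pair_big -sumEFin/=.
    over.
  rewrite integral_sum ?pair_big//= => -[i j].
  apply: (@bounded_integrable _ _ _ _ _ (C * C)) => [|w]; last exact: uu_bound.
  exact: measurable_funM.
rewrite -[X in (X%:R * _)%:E]card_ord mulr_natl -sumr_const -sumEFin.
apply: lee_sum => i _; rewrite (bigD1 i)//= big1 ?adde0; last first.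
  by move=> j ji; rewrite iid_uncorrelated// eq_sym.
rewrite -[leRHS]mule1 -(@probability_setT _ _ _ P) -integral_cst//.
apply: ge0_le_integral => //.
- by move=> w _; rewrite lee_fin -expr2 sqr_ge0.
- by apply/measurable_EFinP; exact: measurable_funM.
- by move=> w _; rewrite lee_fin (le_trans (ler_norm _)).
Qed.

End iid_sample.

(** * Truncation of nonnegative functions at integer levels *)

Lemma cvg_mine_nat (R : realType) (x : \bar R) : (0 <= x)%E ->
  mine x N%:R%:E @[N --> \oo] --> x.
Proof.
case: x => [r _|_|//]; last first.
  under eq_fun do rewrite min_r ?leey//.
  by apply/cvgeryP; exact: cvgr_idn.
apply: cvg_near_cst; near=> N; apply/eqP; rewrite min_l// lee_fin.
by near: N; exact: nbhs_infty_ger.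
Unshelve. all: by end_near. Qed.

Section truncation.
Context (R : realType) (d : measure_display) (T : measurableType d)
  (mu : probability T R) (f : T -> \bar R).
Hypotheses (mf : measurable_fun [set: T] f) (f0 : forall t, (0 <= f t)%E).

Definition trunc (N : nat) (t : T) : R := fine (mine (f t) N%:R%:E).

Lemma EFin_trunc N t : (trunc N t)%:E = mine (f t) N%:R%:E.
Proof.
rewrite fineK// fin_numE; apply/andP; split.
  by rewrite -ltNye lt_min ltNyr andbT (lt_le_trans _ (f0 t)).
by rewrite -ltey gt_min ltry orbT.
Qed.

Lemma trunc_ge0 N t : 0 <= trunc N t.
Proof. by rewrite -lee_fin EFin_trunc le_min f0 lee_fin ler0n. Qed.

Lemma trunc_le N t : trunc N t <= N%:R.
Proof. by rewrite -lee_fin EFin_trunc ge_min lexx orbT. Qed.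

Lemma trunc_le_fun N t : ((trunc N t)%:E <= f t)%E.
Proof. by rewrite EFin_trunc ge_min lexx. Qed.

Lemma measurable_trunc N : measurable_fun [set: T] (trunc N).
Proof.
apply/measurable_EFinP; apply: (eq_measurable_fun (fun t => mine (f t) N%:R%:E)).
  by move=> t _; rewrite /= EFin_trunc.
exact: measurable_mine.
Qed.

Lemma cvg_integral_trunc :
  (\int[mu]_t (trunc N t)%:E)%E @[N --> \oo] --> (\int[mu]_t f t)%E.
Proof.
have -> : (\int[mu]_t f t = \int[mu]_t limn (fun N => (trunc N t)%:E))%E.
  apply: eq_integral => t _; apply/esym/cvg_lim => //.
  under eq_fun do rewrite EFin_trunc; exact: cvg_mine_nat.
apply: cvg_monotone_convergence => //.
- by move=> N; apply/measurable_EFinP; exact: measurable_trunc.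
- by move=> N t _; rewrite lee_fin trunc_ge0.
- move=> t _ N M NM; rewrite !EFin_trunc le_min ge_min lexx/= ge_min.
  by rewrite lee_fin ler_nat NM orbT.
Qed.

Lemma trunc_excess_ge0 N t : (0 <= f t - (trunc N t)%:E)%E.
Proof. by rewrite sube_ge0 ?trunc_le_fun. Qed.

Lemma measurable_trunc_excess N :
  measurable_fun [set: T] (fun t => f t - (trunc N t)%:E)%E.
Proof.
by apply: emeasurable_funB => //; apply/measurable_EFinP; exact: measurable_trunc.
Qed.

Lemma integral_trunc_excess N : (\int[mu]_t f t =
  \int[mu]_t (f t - (trunc N t)%:E) + \int[mu]_t (trunc N t)%:E)%E.
Proof.
rewrite -ge0_integralD//; last 4 first.
- by move=> t _; exact: trunc_excess_ge0.
- exact: measurable_trunc_excess.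
- by move=> t _; rewrite lee_fin trunc_ge0.
- by apply/measurable_EFinP; exact: measurable_trunc.
by apply: eq_integral => t _; rewrite subeK.
Qed.

Lemma integral_trunc_fin N : (\int[mu]_t (trunc N t)%:E)%E \is a fin_num.
Proof.
apply: integrable_fin_num => //.
apply: (@bounded_integrable _ _ _ _ _ N%:R) => [|t]; first exact: measurable_trunc.
by rewrite ger0_norm ?trunc_ge0// trunc_le.
Qed.

End truncation.

Lemma markov_ge0 (R : realType) (d : measure_display) (T : measurableType d)
    (P : probability T R) (Z : T -> \bar R) (c : R) :
  measurable_fun [set: T] Z -> (forall t, 0 <= Z t)%E -> 0 < c ->
  (c%:E * P [set t | c%:E <= Z t] <= \int[P]_t Z t)%E.
Proof.
move=> mZ Z0 c0.
have := @le_integral_comp_abse _ _ _ P _ measurableT Z c id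
  (@measurable_id _ _ _) (fun _ => id) (fun _ _ _ _ => id) mZ c0.
rewrite setTI; under eq_set do rewrite gee0_abs//.
by under eq_integral do rewrite gee0_abs//.
Qed.

Section one_sided_lln.
Context (R : realType) (dY : measure_display) (Y : measurableType dY)
  (mu : probability Y R) (fp fm : Y -> \bar R).
Hypotheses (mfp : measurable_fun [set: Y] fp) (fp0 : forall y, (0 <= fp y)%E)
  (mfm : measurable_fun [set: Y] fm) (fm0 : forall y, (0 <= fm y)%E)
  (pm : (\int[mu]_y fp y < \int[mu]_y fm y)%E).

(** Monotone convergence provides [K] for which the truncated [fm] still has larger mean than [fp];
    [e] is half of that gap. Then [L] is taken so large that the discarded mean of [fp] is at most
    [e / 2], which Markov's inequality at threshold [e] turns into probability 1/2. *)
Lemma truncation_gap : exists K L (e : R),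
  [/\ 0 < e, (\int[mu]_y (trunc fp L y)%:E + (e *+ 2)%:E <=
               \int[mu]_y (trunc fm K y)%:E)%E &
      (\int[mu]_y (fp y - (trunc fp L y)%:E) <= (e / 2)%:E)%E].
Proof.
have a_fin : (\int[mu]_y fp y)%E \is a fin_num.
  by rewrite ge0_fin_numE ?integral_ge0// (lt_le_trans pm) ?leey.
have [K _ /(_ K (leqnn K)) /= aK] := cvg_integral_trunc mfm fm0 (open_ereal_gt' pm).
pose a := fine (\int[mu]_y fp y); have aE : (\int[mu]_y fp y = a%:E)%E by rewrite fineK.
pose b := fine (\int[mu]_y (trunc fm K y)%:E).
have bE : (\int[mu]_y (trunc fm K y)%:E = b%:E)%E by rewrite fineK ?integral_trunc_fin.
have ab : a < b by rewrite -lte_fin -aE -bE.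
pose e := (b - a) / 2; have e0 : 0 < e by rewrite divr_gt0// subr_gt0.
have ae : ((a - e / 2)%:E < \int[mu]_y fp y)%E.
  by rewrite aE lte_fin ltrBlDr ltrDl divr_gt0.
have [L _ /(_ L (leqnn L)) /= aL] := cvg_integral_trunc mfp fp0 (open_ereal_gt' ae).
have aLE := integral_trunc_excess mu mfp fp0 L.
move: aL aLE; rewrite aE -(fineK (integral_trunc_fin mu mfp fp0 L)).
set l := fine _ => al aLE.
exists K, L, e; split => //.
  rewrite -(fineK (integral_trunc_fin mu mfp fp0 L)) -/l bE -EFinD lee_fin.
  have : (l%:E <= a%:E)%E.
    rewrite aLE leeDr//; apply: integral_ge0 => y _; exact: trunc_excess_ge0.
  by rewrite lee_fin /e mulr2n -splitr; lra.
have -> : (\int[mu]_y (fp y - (trunc fp L y)%:E) = a%:E - l%:E)%E by rewrite aLE addeK.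
by rewrite -EFinB lee_fin; move: al; rewrite lte_fin; lra.
Qed.

(* Only P(sum >= 0) -/-> 1 is needed, so the tail of fp beyond the truncation
   level may be handled by Markov's inequality with the constant bound 1/2. *)
Lemma one_sided_lln : exists N : nat, forall n, (N <= n)%N ->
  forall (dO : measure_display) (Omega : measurableType dO)
    (P : probability Omega R) (X : 'I_n -> {RV P >-> Y}),
  (forall A : 'I_n -> set Y, (forall i, measurable (A i)) ->
    P (\bigcap_(i in [set: 'I_n]) (X i @^-1` A i)) = (\prod_(i < n) mu (A i))%E) ->
  forall E : set Omega, measurable E ->
    E `<=` [set w | (\sum_i fm (X i w) <= \sum_i fp (X i w))%E] ->
  (P E <= (3 / 4)%:E)%E.
Proof.
have [K [L [e [e0 gap tail]]]] := truncation_gap.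
pose g y := trunc fp L y - trunc fm K y.
have mg : measurable_fun [set: Y] g.
  by apply: measurable_funB; exact: measurable_trunc.
have gC y : `|g y| <= L%:R + K%:R.
  rewrite (le_trans (ler_normB _ _))// lerD// ger0_norm ?trunc_ge0// trunc_le//.
have ig : mu.-integrable [set: Y] (EFin \o g) by exact: bounded_integrable mg gC.
pose M := fine (\int[mu]_y (g y)%:E).
have ME : (\int[mu]_y (g y)%:E = M%:E)%E by rewrite fineK// integrable_fin_num.
have M2 : M <= - (e *+ 2).
  move: gap; rewrite -lee_fin -ME integralB_EFin//; last 2 first.
  - apply: (@bounded_integrable _ _ _ _ _ L%:R) => [|y]; first exact: measurable_trunc.
    by rewrite ger0_norm ?trunc_ge0// trunc_le.
  - apply: (@bounded_integrable _ _ _ _ _ K%:R) => [|y]; first exact: measurable_trunc.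
    by rewrite ger0_norm ?trunc_ge0// trunc_le.
  rewrite -(fineK (integral_trunc_fin mu mfp fp0 L)).
  rewrite -(fineK (integral_trunc_fin mu mfm fm0 K)).
  by rewrite -EFinD -EFinB !lee_fin; lra.
pose u y := g y - M; pose C := L%:R + K%:R + `|M|.
have mu_ : measurable_fun [set: Y] u by exact: measurable_funB.
have uC y : `|u y| <= C by rewrite (le_trans (ler_normB _ _))// lerD.
have u0 : (\int[mu]_y (u y)%:E = 0)%E.
  rewrite integralB_EFin//; last exact: finite_measure_integrable_cst.
  rewrite ME integral_cst// [X in (_ * X)%E](_ : _ = 1%E) ?mule1 ?subee//.
  exact: probability_setT.
pose h y := (fp y - (trunc fp L y)%:E)%E.
have h0 y : (0 <= h y)%E by exact: trunc_excess_ge0.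
have mh : measurable_fun [set: Y] h by exact: measurable_trunc_excess.
(* From [4 * C^2 / e^2] samples on, the Chebyshev bound [n * C^2 / (n * e)^2] is at most 1/4. *)
exists (Num.truncn (4 * (C * C) / (e * e))).+1 => n Nn dO Omega P X iidX E mE EX.
have n0 : 0 < n%:R :> R by rewrite ltr0n (leq_trans _ Nn).
have nC : 4 * (C * C) <= n%:R * (e * e).
  rewrite -ler_pdivrMr ?mulr_gt0//; apply: le_trans (ltW (truncnS_gt _)) _.
  by rewrite ler_nat.
have ne0 : 0 < n%:R * e by rewrite mulr_gt0.
have mX i (dZ : measure_display) (Z : measurableType dZ) (f : Y -> Z) :
    measurable_fun [set: Y] f -> measurable_fun [set: Omega] (fun w => f (X i w)).
  by move=> mf; exact: measurableT_comp.
pose B1 := [set w | ((n%:R * e)%:E <= \sum_i h (X i w))%E].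
pose B2 := [set w | (((n%:R * e) ^+ 2)%:E <= ((\sum_i u (X i w)) ^+ 2)%:E)%E].
have msh : measurable_fun [set: Omega] (fun w => \sum_i h (X i w))%E.
  by apply: emeasurable_sum => i; exact: mX.
have msu : measurable_fun [set: Omega] (fun w => ((\sum_i u (X i w)) ^+ 2)%:E).
  apply/measurable_EFinP; apply: measurable_funX.
  by apply: measurable_sum => i; exact: mX.
have mB1 : measurable B1.
  by rewrite -[B1]setTI; exact: emeasurable_fun_c_infty.
have mB2 : measurable B2.
  by rewrite -[B2]setTI; exact: emeasurable_fun_c_infty.
(* Outside [B1] the discarded part of [fp] sums to less than [n * e], so on [E] the truncated
   difference [g] sums to more than [- n * e]. Its mean sum is at most [- 2 * n * e], which forces a
   deviation of at least [n * e]. *)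
have EB : E `<=` B1 `|` B2.
  move=> w /EX /= fmp; have [|hlt] := leP (n%:R * e)%:E (\sum_i h (X i w))%E.
    by left.
  right; rewrite /B2/= lee_fin.
  have sh0 : (0 <= \sum_i h (X i w))%E by exact: sume_ge0.
  have hfin : (\sum_i h (X i w))%E \is a fin_num.
    by rewrite ge0_fin_numE// (lt_trans hlt)// ltry.
  move: hlt; rewrite -(fineK hfin); set s := fine _; rewrite lte_fin => slt.
  have : ((\sum_i trunc fm K (X i w))%:E <= (\sum_i trunc fp L (X i w))%:E + s%:E)%E.
    rewrite -!sumEFin fineK// -big_split/=.
    apply: (@le_trans _ _ (\sum_i fm (X i w))%E).
      by apply: lee_sum => i _; exact: trunc_le_fun.
    apply: le_trans fmp _; apply: lee_sum => i _.
    by rewrite /h addeC subeK.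
  rewrite -EFinD lee_fin => ineq.
  have su : \sum_i u (X i w) =
      \sum_i trunc fp L (X i w) - \sum_i trunc fm K (X i w) - n%:R * M.
    rewrite /u /g !sumrB sumr_const card_ord mulr_natl//.
  have nM : n%:R * M <= n%:R * (- (e *+ 2)) by rewrite ler_pM2l.
  have ltu : n%:R * e <= \sum_i u (X i w).
    rewrite su; move: nM; rewrite mulr2n mulrN mulrDr; lra.
  by rewrite ler_pXn2r// nnegrE ltW// (lt_le_trans _ ltu).
(* Markov's inequality bounds [B1] by 1/2 and Chebyshev's bounds [B2] by 1/4, whence 3/4. *)
have P1 : (P B1 <= (1 / 2)%:E)%E.
  have sh0 w : (0 <= \sum_i h (X i w))%E by exact: sume_ge0.
  have := markov_ge0 P msh sh0 ne0.
  rewrite ge0_integral_sum//; last by move=> i; exact: mX.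
  under eq_bigr do rewrite (iid_ge0_integral iidX)//.
  move=> /le_trans Pe; rewrite -(@lee_pmul2l _ (n%:R * e)%:E)//; apply: Pe.
  rewrite -EFinM mul1r -mulrA mulr_natl -[in leRHS](card_ord n) -sumr_const.
  by rewrite -sumEFin; apply: lee_sum => i _.
have P2 : (P B2 <= (1 / 4)%:E)%E.
  have ne2 : 0 < (n%:R * e) ^+ 2 by rewrite exprn_gt0.
  have s0 w : (0 <= ((\sum_i u (X i w)) ^+ 2)%:E)%E by rewrite lee_fin sqr_ge0.
  have := le_trans (markov_ge0 P msu s0 ne2) (iid_second_moment iidX mu_ uC u0).
  move=> /le_trans Pe; rewrite -(@lee_pmul2l _ ((n%:R * e) ^+ 2)%:E)//; apply: Pe.
  rewrite -EFinM lee_fin mul1r ler_pdivlMr// exprMn expr2 -!mulrA ler_pM2l// mulrA.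
  by rewrite [n%:R * _]mulrC mulrC in nC *; lra.
apply: le_trans (le_measure _ _ _ EB) _; rewrite ?inE//; first exact: measurableU.
apply: le_trans (measureU2 _ _ _) _ => //.
apply: le_trans (leeD P1 P2) _; rewrite -EFinD lee_fin; lra.
Qed.
End one_sided_lln.

(** * Log-likelihood ratios *)

Section llr_facts.
Context (R : realType) (d : measure_display) (Y : measurableType d)
  (W : bi_channel R Y).

(** Clearing the denominator covers vanishing densities uniformly. The condition [0 < ch_dens W 0 y]
    excludes the case 0/0, where the LLR is -oo although the second inequality holds. *)
Lemma llr_geE (c : R) (y : Y) : (c%:E <= llr W y)%E =
  (0 < ch_dens W 0 y) && (expR c * ch_dens W 1 y <= ch_dens W 0 y).
Proof.
have := ch_dens_ge0 W 0 y; have := ch_dens_ge0 W 1 y; rewrite /llr.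
set p := ch_dens W 0 y; set q := ch_dens W 1 y.
rewrite le_eqVlt => /predU1P[<-|q0] p0.
  rewrite inve0; move: p0; rewrite le_eqVlt => /predU1P[<-|p0].
    by rewrite mul0e/= lexx ltxx leeNy_eq.
  by rewrite gt0_muley ?lte_fin//= leey mulr0 p0 ltW.
rewrite inver gt_eqF// -EFinM; move: p0; rewrite le_eqVlt => /predU1P[<-|p0].
  by rewrite mul0r/= lexx ltxx leeNy_eq.
have pq : 0 < p / q by rewrite divr_gt0.
rewrite lne_EFin// lee_fin p0/= -ler_pdivlMr//.
by rewrite -[in RHS](@lnK _ (p / q)) ?posrE// ler_expR.
Qed.

Lemma measurable_llr : measurable_fun [set: Y] (llr W).
Proof.
move=> mD; apply: (measurability _ (ErealGenCInfty.measurableE R)) => //.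
move=> _ [_ [c ->] <-]; rewrite setTI.
rewrite (_ : _ @^-1` _ = (ch_dens W 0 @^-1` `]0, +oo[) `&`
    ((fun y => ch_dens W 0 y - expR c * ch_dens W 1 y) @^-1` `[0, +oo[)).
  apply: measurableI; rewrite -[X in measurable X]setTI.
    by apply: ch_dens_meas => //; exact: measurable_itv.
  have mf : measurable_fun [set: Y]
      (fun y => ch_dens W 0 y - expR c * ch_dens W 1 y).
    apply: measurable_funB; first exact: ch_dens_meas.
    by apply: measurable_funM => //; exact: ch_dens_meas.
  by apply: mf => //; exact: measurable_itv.
apply/seteqP; split=> y; rewrite /= !in_itv/= !andbT llr_geE subr_ge0.
  by move=> /andP[].
by move=> [-> ->].
Qed.

(** On this event [P(y|0) <= exp(-k) P(y|1)]; integrating against the reference measure leaves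
    [exp(-k)] times a probability under input 1. *)
Lemma llr_lower_tail (k : R) :
  (ch_law W 0%R [set y | (llr W y <= (- k)%:E)%E] <= (expR (- k))%:E)%E.
Proof.
set A := [set y | _].
have mA : measurable A.
  by rewrite -[A]setTI; apply: emeasurable_fun_infty_c => //; exact: measurable_llr.
have md x : measurable_fun A (fun y => (ch_dens W x y)%:E).
  by apply/measurable_funTS/measurable_EFinP; exact: ch_dens_meas.
rewrite ch_lawE//; apply: (@le_trans _ _
    (\int[ch_ref W]_(y in A) ((expR (- k))%:E * (ch_dens W 1%R y)%:E))%E).
  apply: ge0_le_integral => //.
  - by move=> y _; rewrite lee_fin ch_dens_ge0.
  - by apply: emeasurable_funM => //; exact: measurable_cst.
  - move=> y Ay; rewrite -EFinM lee_fin leNgt; apply/negP => plt.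
    have p0 : 0 < ch_dens W 0 y.
      by apply: le_lt_trans plt; rewrite mulr_ge0 ?expR_ge0 ?ch_dens_ge0.
    have qp : (expR (- k) * ch_dens W 1 y < ch_dens W 0 y) := plt.
    (* If the density bound failed, the LLR would reach some [c] strictly above [- k]: any such [c]
       when [P(y|1) = 0], the logarithm of the ratio otherwise. *)
    have [c ck cp] : exists2 c, - k < c &  expR c * ch_dens W 1 y <= ch_dens W 0 y.
      have := ch_dens_ge0 W 1 y; rewrite le_eqVlt => /predU1P[<-|q0].
        by exists (- k + 1); rewrite ?ltrDl// mulr0 ltW.
      exists (ln (ch_dens W 0 y / ch_dens W 1 y)).
        by rewrite -ltr_expR lnK ?posrE ?divr_gt0// ltr_pdivlMr.
      by rewrite lnK ?posrE ?divr_gt0// mulfVK// gt_eqF.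
    have : (c%:E <= llr W y)%E by rewrite llr_geE p0.
    by move=> /le_trans /(_ Ay); rewrite lee_fin leNgt ck.
rewrite ge0_integralZl//; last by move=> y _; rewrite lee_fin ch_dens_ge0.
have <- := ch_lawE W 1 mA.
by rewrite -[leRHS]mule1 lee_pmul2l ?lte_fin ?expR_gt0// probability_le1.
Qed.

(** Layer-cake bound: a nonnegative value cut at [N] is at most the number of integers [k < N] that
    it reaches. *)
Lemma trunc_llr_neg_le (N : nat) (y : Y) :
  trunc (fun y => maxe (- llr W y) 0)%E N y <=
  \sum_(k < N) \1_[set y | (llr W y <= (- k%:R)%:E)%E] y.
Proof.
elim: N => [|N IH].
  rewrite big_ord0 -lee_fin EFin_trunc ?ge_min ?lexx ?orbT// => t.
  by rewrite le_max lexx orbT.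
rewrite big_ord_recr/= -lee_fin; set f := (fun y => _) in IH *.
have f0 t : (0 <= f t)%E by rewrite /f le_max lexx orbT.
move: IH; rewrite -lee_fin => IH; rewrite EFinD.
apply: le_trans (leeD IH (lexx _)); rewrite !EFin_trunc//.
have [fN|Nf] := leP (f y) N%:R%:E.
  have fS : (f y <= N.+1%:R%:E)%E by rewrite (le_trans fN)// lee_fin ler_nat.
  by rewrite !min_l// leeDl// lee_fin.
rewrite indicE mem_set/=; last first.
  move: Nf; rewrite /f lt_max => /orP[|]; last by rewrite lte_fin ltrn0.
  by move=> Nf; rewrite EFinN leeNr ltW.
apply: (@le_trans _ _ N.+1%:R%:E); first by rewrite ge_min lexx orbT.
by rewrite -EFinD lee_fin -natr1.
Qed.

(** The tail bounds sum to a geometric series of ratio [exp(-1)], bounding all truncated integrals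
    by the same constant; an infinite integral would make them exceed it. *)
Lemma integral_llr_neg_fin :
  (\int[ch_law W 0%R]_y maxe (- llr W y) 0 < +oo)%E.
Proof.
pose f y := maxe (- llr W y)%E 0%E.
have f0 t : (0 <= f t)%E by rewrite /f le_max lexx orbT.
have mf : measurable_fun [set: Y] f.
  by apply: measurable_maxe => //; apply: measurableT_comp => //; exact: measurable_llr.
pose A (k : nat) := [set y | (llr W y <= (- k%:R)%:E)%E].
have mA k : measurable (A k).
  by rewrite -[A k]setTI; apply: emeasurable_fun_infty_c => //; exact: measurable_llr.
pose r : R := expR (- 1).
have r1 : r < 1 by rewrite expR_lt1 ltrN10.
pose C := (1 - r)^-1.
have bound N : (\int[ch_law W 0%R]_y (trunc f N y)%:E <= C%:E)%E.
  apply: (@le_trans _ _ (\int[ch_law W 0%R]_y (\sum_(k < N) (\1_(A k) y)%:E))%E).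
    apply: ge0_le_integral => //.
    - by move=> y _; rewrite lee_fin trunc_ge0.
    - by apply/measurable_EFinP; exact: measurable_trunc.
    - apply: emeasurable_sum => k; apply/measurable_EFinP.
      exact: measurable_indic.
    - by move=> y _; rewrite sumEFin lee_fin; exact: trunc_llr_neg_le.
  rewrite ge0_integral_sum//; last first.
    by move=> k; apply/measurable_EFinP; exact: measurable_indic.
  apply: (@le_trans _ _ (\sum_(k < N) (r ^+ k)%:E)%E).
    apply: lee_sum => k _; rewrite integral_indic// setIT.
    apply: le_trans (llr_lower_tail _) _.
    by rewrite lee_fin /r -expRM_natl mulrN1.
  rewrite sumEFin lee_fin.
  have rS := subrX1 r N.
  have r0 : 0 <= r ^+ N by rewrite exprn_ge0 ?expR_ge0.
  rewrite /C -[leRHS]mul1r ler_pdivlMr ?subr_gt0//; lra.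
rewrite ltNge; apply/negP; rewrite leye_eq => /eqP foo.
have cv := cvg_integral_trunc mf f0.
move: (cv (ch_law W 0)); rewrite foo => /(_ _ (open_ereal_gt' (ltry C))).
by case=> N _ /(_ N (leqnn N)) /=; rewrite ltNge bound.
Qed.

End llr_facts.

(** * The threshold bound *)

(** This is the positivity of the cost at the sign point, with its scale divided out and the terms
    sorted by sign. *)
Lemma lp_decides_zero_sums (R : realType) (m n w : nat) (H : 'M['F_2]_(m, n))
    (g : 'I_n -> \bar R) : (2 <= w)%N ->
  (forall j : 'I_m, #|[set i : 'I_n | H j i == 1]%SET| = w) ->
  (0 < n)%N -> lp_decides_zero H g ->
  (\sum_i (w%:R - 1)%:E * maxe (- g i) 0 <= \sum_i maxe (g i) 0)%E.
Proof.
move=> w2 Hw n0 Hg; have gNy i := lp_decides_zero_gtNy w2 Hw i Hg.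
have fp0 i : (0 <= maxe (g i) 0)%E by rewrite le_max lexx orbT.
(* One LLR equal to +oo makes the right side infinite; otherwise all are real and the cost is an
   ordinary sum. *)
have [[i gi]|/forallNP gy] := pselect (exists i, g i = +oo%E).
  rewrite (_ : (\sum_i maxe (g i) 0)%E = +oo%E) ?leey//; apply/eqP.
  rewrite -leye_eq (bigD1 i)//= gi max_l ?leey// leeDl//.
  exact: sume_ge0.
have gE i : g i = (fine (g i))%:E.
  by rewrite fineK// fin_numE gNy; apply/eqP/gy.
have := lp_decides_zero_sign_point w2 Hw Hg n0.
rewrite /lp_cost; under eq_bigr do rewrite gE mxE -EFinM.
rewrite sumEFin lte_fin.
under eq_bigr do rewrite mulrCA.
rewrite -mulr_sumr pmulr_rgt0 ?invr_gt0// => lt0.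
under eq_bigr do rewrite gE -EFinN -EFin_max -EFinM.
under [leRHS]eq_bigr do rewrite gE -EFin_max.
rewrite !sumEFin lee_fin -subr_ge0 -sumrB; apply: (le_trans (ltW lt0)).
apply: ler_sum => i _; rewrite [X in (X < 0)%E]gE lte_fin; case: ltP => r0.
  by rewrite max_l ?oppr_ge0 ?(ltW r0)// sub0r mulrN opprK mulrC.
by rewrite max_r ?oppr_le0// mulr0 subr0 mulr1.
Qed.

Lemma lee_neg_ratio (R : realType) (c : R) (a b p : \bar R) :
  (0 <= b)%E -> (b < +oo)%E -> (p != 0 -> b != 0)%E -> (c%:E * b <= a)%E ->
  (c%:E <= neg_ratio a (- b) p)%E.
Proof.
rewrite /neg_ratio; case: eqP => [_|_]; first by rewrite leey.
case: b => [b|//|//] b0 _ /(_ isT) bn0 cba.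
have {}b0 : 0 < b.
  by rewrite lt_neqAle -lee_fin b0 eq_sym andbT; move: bn0; rewrite eqe.
rewrite -EFinN inver oppr_eq0 gt_eqF// invrN EFinN muleN oppeK.
by rewrite lee_pdivlMr.
Qed.

Section threshold.
Context (R : realType) (w_col w_row : nat) (hcol : (1 <= w_col)%N)
  (hrow : (2 <= w_row)%N) (m n : nat -> nat)
  (H : forall k : nat, 'M['F_2]_(m k, n k))
  (hn : n k @[k --> \oo] --> \oo)
  (hH : forall k, regular_pcm w_col w_row (H k))
  (dY : measure_display) (Y : measurableType dY) (W : bi_channel R Y)
  (dO : nat -> measure_display) (Omega : forall k, measurableType (dO k))
  (P : forall k, probability (Omega k) R)
  (Yout : forall k, 'I_(n k) -> {RV (P k) >-> Y})
  (hY : forall k, memoryless_output W 0 (Yout k))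
  (hLP : P k [set w | lp_decides_zero (H k) (fun i => llr W (Yout k i w))]
           @[k --> \oo] --> 1%E).

Lemma llr_mean_bound :
  ((w_row%:R - 1)%:E * \int[ch_law W 0%R]_y maxe (- llr W y) 0 <=
   \int[ch_law W 0%R]_y maxe (llr W y) 0)%E.
Proof.
have c0 : 0 <= w_row%:R - 1 :> R by rewrite subr_ge0 ler1n ltnW.
pose fp y := maxe (llr W y) 0%E; pose fn y := maxe (- llr W y)%E 0%E.
have mX := measurable_llr W.
have mfp : measurable_fun [set: Y] fp by exact: measurable_maxe.
have mfn : measurable_fun [set: Y] fn.
  by apply: measurable_maxe => //; exact: measurableT_comp.
have fp0 y : (0 <= fp y)%E by rewrite le_max lexx orbT.
have fn0 y : (0 <= fn y)%E by rewrite le_max lexx orbT.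
pose fm y := ((w_row%:R - 1)%:E * fn y)%E.
have mfm : measurable_fun [set: Y] fm.
  by apply: emeasurable_funM => //; exact: measurable_cst.
have fm0 y : (0 <= fm y)%E by rewrite mule_ge0.
rewrite leNgt; apply/negP; rewrite -(@ge0_integralZl _ _ _ _ _ measurableT fn)// => lt_pm.
have [N lln] := one_sided_lln mfp fp0 mfm fm0 lt_pm.
have lt34 : ((3 / 4)%:E < 1 :> \bar R)%E by rewrite lte_fin; lra.
have [K1 _ big] := hLP (open_ereal_gt' lt34).
have [K2 _ big2] := hn (nbhs_infty_ge N.+1).
pose k := maxn K1 K2.
have nk : (N < n k)%N by apply: big2; rewrite /= leq_maxr.
have n0 : (0 < n k)%N by exact: leq_ltn_trans nk.
have /= := big k (leq_maxl _ _); rewrite ltNge => /negP; apply.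
have [Hcol Hrow] := hH k.
(* A column contains at least one 1, so there is a row; this makes the polytope compact and the
   decoding event measurable. *)
have m0 : (0 < m k)%N.
  have := Hcol (Ordinal n0); case: (m k) (H k) => [|//] Hk /esym w0.
  by move: hcol; rewrite w0 ltnNge (leq_trans (max_card _))// card_ord.
apply: (lln (n k) (ltnW nk) _ _ _ (@Yout k)) => [A mA||].
- by rewrite hY//; apply: eq_bigr => i _; rewrite mxE.
- apply: (measurable_lp_decides_zero hrow Hrow m0 (g := fun i w => llr W (@Yout k i w))).
  by move=> i; exact: measurableT_comp.
- by move=> w /= Hw; exact: lp_decides_zero_sums Hrow n0 Hw.
Qed.

End threshold.

(** A nonnegative function with zero integral vanishes almost everywhere, so a zero mean of the
    negative part would make the event null. *)
Lemma llr_neg_mean_neq0 (R : realType) (dY : measure_display)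
    (Y : measurableType dY) (W : bi_channel R Y) :
  ch_law W 0 [set y | (llr W y < 0)%E] != 0%E ->
  (\int[ch_law W 0%R]_y maxe (- llr W y) 0 != 0)%E.
Proof.
have mX := measurable_llr W.
apply: contra_neq => int0.
have mf : measurable_fun [set: Y] (fun y => maxe (- llr W y) 0)%E.
  by apply: measurable_maxe => //; exact: measurableT_comp.
have [+ _] := ae_eq_integral_abs (ch_law W 0) measurableT mf.
have -> : (\int[ch_law W 0%R]_y `|maxe (- llr W y) 0| = 0)%E.
  by rewrite -[RHS]int0; apply: eq_integral => y _; rewrite gee0_abs// le_max lexx orbT.
move=> /(_ erefl) [N [mN N0 sub]].
apply: (subset_measure0 _ mN _ N0).
  by rewrite -[X in measurable X]setTI; apply: emeasurable_fun_infty_o.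
move=> y /= Xy; apply: sub => /= /(_ I).
by rewrite max_l ?oppe_ge0 ?ltW// => /eqP; rewrite oppe_eq0 lt_eqF.
Qed.

Lemma distributed_as_llrE (R : realType) (dY : measure_display)
    (Y : measurableType dY) (W : bi_channel R Y) (dT : measure_display)
    (T : measurableType dT) (Q : probability T R) (Gamma : {RV Q >-> \bar R})
    (f : \bar R -> \bar R) :
  distributed_as_llr W Gamma -> measurable_fun [set: \bar R] f ->
  (forall x, 0 <= f x)%E ->
  (\int[distribution Q Gamma]_g f g = \int[ch_law W 0%R]_y f (llr W y))%E.
Proof.
move=> GW mf f0.
pose X : {mfun Y >-> \bar R} :=
  HB.pack (llr W) (isMeasurableFun.Build _ _ _ _ _ (measurable_llr W)).
rewrite (eq_measure_integral (distribution (ch_law W 0) X))/=; last first.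
  by move=> A mA _; exact: GW.
by rewrite ge0_integral_distribution.
Qed.

Theorem theorem6 (R : realType)
  (w_col w_row : nat) (hcol : (1 <= w_col)%N) (hrow : (2 <= w_row)%N)
  (m n : nat -> nat) (H : forall k : nat, 'M['F_2]_(m k, n k))
  (hn : n k @[k --> \oo] --> \oo)
  (hH : forall k, regular_pcm w_col w_row (H k))
  (dY : measure_display) (Y : measurableType dY)
  (W : bi_channel R Y) (hW : output_symmetric W)
  (dO : nat -> measure_display) (Omega : forall k, measurableType (dO k))
  (P : forall k, probability (Omega k) R)
  (Yout : forall k, 'I_(n k) -> {RV (P k) >-> Y})
  (hY : forall k, memoryless_output W 0 (Yout k))
  (hLP : P k [set w | lp_decides_zero (H k) (fun i => llr W (Yout k i w))]
           @[k --> \oo] --> 1%E)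
  (dT : measure_display) (T : measurableType dT) (Q : probability T R)
  (Gamma : {RV Q >-> \bar R}) (hGamma : distributed_as_llr W Gamma) :
  ((w_row%:R - 1)%:E <=
     neg_ratio (mean_on Q Gamma [set t | 0 <= Gamma t])
               (mean_on Q Gamma [set t | Gamma t < 0])
               (Q [set t | Gamma t < 0]))%E
  /\
  ((w_row%:R - 1)%:E <=
     neg_ratio (\int[distribution Q Gamma]_(g in [set g | 0 <= g]) g)
               (\int[distribution Q Gamma]_(g in [set g | g < 0]) g)
               (distribution Q Gamma [set g | g < 0]))%E.
Proof.
have mpos : measurable_fun [set: \bar R] (fun x => maxe x 0)%E.
  exact: measurable_maxe.
have mneg : measurable_fun [set: \bar R] (fun x => maxe (- x) 0)%E.
  exact: measurable_maxe.
have pos0 (x : \bar R) : (0 <= maxe x 0)%E by rewrite le_max lexx orbT.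
have neg0 (x : \bar R) : (0 <= maxe (- x) 0)%E by exact: pos0.
have in_set_bool (S : Type) (p : pred S) x : (x \in [set y | p y]) = p x.
  by apply/idP/idP => [/set_mem|/mem_set].
set D := distribution Q Gamma.
(* Both forms of the ratio reduce to [a] over [- b], the means of the positive and negative parts
   under the law of [Gamma]. *)
pose a := (\int[D]_g maxe g 0)%E; pose b := (\int[D]_g maxe (- g) 0)%E.
have QD : Q [set t | (Gamma t < 0)%E] = D [set g | (g < 0)%E] by [].
have aE : a = (\int[ch_law W 0%R]_y maxe (llr W y) 0)%E.
  exact: (distributed_as_llrE (f := fun x => maxe x 0%E)).
have bE : b = (\int[ch_law W 0%R]_y maxe (- llr W y) 0)%E.
  exact: (distributed_as_llrE (f := fun x => maxe (- x) 0)%E).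
have bound : ((w_row%:R - 1)%:E <= neg_ratio a (- b) (D [set g | (g < 0)%E]))%E.
  apply: lee_neg_ratio.
  - exact: integral_ge0.
  - by rewrite bE integral_llr_neg_fin.
  - rewrite bE /D hGamma; first exact: llr_neg_mean_neq0.
    by rewrite -[X in measurable X]setTI; apply: emeasurable_fun_infty_o.
  - rewrite aE bE; exact: (llr_mean_bound hcol hrow hn hH hY hLP).
have posE (x : \bar R) : maxe x 0%E = if (0 <= x)%E then x else 0%E.
  by case: leP => [x0|x0]; rewrite ?max_l ?max_r// ltW.
have negE (x : \bar R) : (- maxe (- x) 0 = if x < 0 then x else 0)%E.
  case: ltP => x0; first by rewrite max_l ?oppeK// oppe_ge0 ltW.
  by rewrite max_r ?oppe0// oppe_le0.
have DnegE : (\int[D]_g (- maxe (- g) 0) = - b)%E by rewrite integral_ge0N.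
split.
- rewrite QD.
  have -> : mean_on Q Gamma [set t | (0 <= Gamma t)%E] = a.
    rewrite /a ge0_integral_distribution//.
    apply: eq_integral => t _; rewrite /= posE indicE in_set_bool.
    by case: ifP => _; rewrite ?mule1 ?mule0.
  have -> // : mean_on Q Gamma [set t | (Gamma t < 0)%E] = (- b)%E.
  rewrite /b ge0_integral_distribution// -integral_ge0N; last by move=> t _; exact: neg0.
  apply: eq_integral => t _; rewrite /= negE indicE in_set_bool.
  by case: ifP => _; rewrite ?mule1 ?mule0.
- have -> : (\int[D]_(g in [set g | 0 <= g]) g = a)%E.
    rewrite integral_mkcond; apply: eq_integral => g _.
    by rewrite posE patchE in_set_bool.
  have -> // : (\int[D]_(g in [set g | g < 0]) g = - b)%E.
  rewrite -DnegE integral_mkcond; apply: eq_integral => g _.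
  by rewrite negE patchE in_set_bool.
Qed.
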